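(* Let $X=\{x_1,\dots,x_n\}$ with $n\ge2$, $f\in\mathrm{Sym}(X)$, and let $(X,r_f)$ be the corresponding permutation idempotent solution. Let $d\ge2$ be an integer and let $(\mathcal{N}_d,\rho_d)$ be the normalized $d$-Veronese solution associated to $(X,r_f)$. Then $(\mathcal{N}_d,\rho_d)$ is again a permutation idempotent solution of order $n$. Moreover, enumerating lexicographically $$\mathcal{N}_d=\{w_1=x_1^d,\ w_2=x_1^{d-1}x_2,\ \dots,\ w_n=x_1^{d-1}x_n\},$$ one has $$\rho_d(w_p,w_q)=(F(w_q),w_q),\qquad F\in\mathrm{Sym}(\mathcal{N}_d),\quad F(w_q)=x_1^{d-1}f^d(x_q),\qquad 1\le p,q\le n.$$
   Context: A permutation idempotent solution on a set $Y$ is a pair $(Y,r_g)$ with $g\in\mathrm{Sym}(Y)$ and $r_g(x,y)=(g(y),y)$; it satisfies the Yang-Baxter (braid) equation and $r_g^2=r_g$. For a finite set-theoretic solution $(X,r)$ of the Yang-Baxter equation write $r(x,y)=({}^xy,x^y)$. The associated monoid is $S=S(X,r)=\langle X\mid xy=y'x'\text{ whenever }r(x,y)=(y',x')\rangle$, graded by word length $|\cdot|$ (for $r=r_f$ the relations are $xy=f(y)y$). It is known that the left and right actions $(x,y)\mapsto{}^xy$, $(x,y)\mapsto x^y$ on $X$ extend uniquely to maps $S\times S\to S$, $(a,b)\mapsto{}^ab$, $(a,b)\mapsto a^b$, satisfying, for all $a,b,u,v\in S$: ${}^a1=1$, ${}^1u=u$, $1^u=1$, $a^1=a$; ${}^{(ab)}u={}^a({}^bu)$;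 $a^{(uv)}=(a^u)^v$; ${}^a(uv)=({}^au)({}^{a^u}v)$; $(ab)^u=(a^{{}^bu})(b^u)$; $({}^uv)(u^v)=uv$; and $|{}^au|=|u|=|u^a|$. Fix the degree-lexicographic order on words with $x_1<\dots<x_n$. Let $\mathcal{N}$ be the set of normal words, i.e. words which are minimal in this order among all words representing the same element of $S$; $\mathrm{Nor}(u)\in\mathcal{N}$ denotes the unique normal word equal in $S$ to $u$, and $\mathcal{N}_d$ is the set of normal words of length $d$. For $r=r_f$, $\mathcal{N}=\{1\}\cup\{x_1^{m}x_q\mid m\ge0,1\le q\le n\}$ and $\mathcal{N}_d=\{x_1^{d-1}x_q\mid1\le q\le n\}$. The normalized $d$-Veronese solution is $(\mathcal{N}_d,\rho_d)$ with $\rho_d:\mathcal{N}_d\times\mathcal{N}_d\to\mathcal{N}_d\times\mathcal{N}_d$, $\rho_d(a,b)=(\mathrm{Nor}({}^ab),\mathrm{Nor}(a^b))$. *)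

(* Defs.v *)
From HB Require Import structures.
From mathcomp Require Import all_boot all_order all_fingroup.
From mathcomp Require Import boolp.

Set Implicit Arguments.
Unset Strict Implicit.
Unset Printing Implicit Defensive.

Import Order.TTheory.

Local Open Scope quotient_scope.
Local Notation repr := generic_quotient.repr.

Section Solutions.
Variable T : Type.
Implicit Type r : T * T -> T * T.

Definition on12 r (t : T * T * T) : T * T * T :=
  let: (x, y, z) := t in ((r (x, y)).1, (r (x, y)).2, z).

Definition on23 r (t : T * T * T) : T * T * T :=
  let: (x, y, z) := t in (x, (r (y, z)).1, (r (y, z)).2).

Definition braided r :=
  forall t, on12 r (on23 r (on12 r t)) = on23 r (on12 r (on23 r t)).

End Solutions.

Definition perm_sol (Y : finType) (g : {perm Y}) (p : Y * Y) : Y * Y :=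
  (g p.2, p.2).

Definition is_perm_idem_sol (Y : finType) (r : Y * Y -> Y * Y) :=
  exists g : {perm Y}, forall x y, r (x, y) = perm_sol g (x, y).

Lemma perm_sol_braided (Y : finType) (g : {perm Y}) : braided (perm_sol g).
Proof. by move=> [[x y] z]. Qed.

Lemma perm_sol_idem (Y : finType) (g : {perm Y}) p :
  perm_sol g (perm_sol g p) = perm_sol g p.
Proof. by []. Qed.

Section AssociatedMonoid.
Variables (T : choiceType) (r : T * T -> T * T).

Inductive congr : seq T -> seq T -> Prop :=
| congr_rel x y : congr [:: x; y] [:: (r (x, y)).1; (r (x, y)).2]
| congr_refl u : congr u u
| congr_sym u v : congr u v -> congr v u
| congr_trans u v w : congr u v -> congr v w -> congr u w
| congr_cat u u' v v' : congr u u' -> congr v v' -> congr (u ++ v) (u' ++ v').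

Definition congrb : rel (seq T) := fun u v => `[< congr u v >].

Lemma congrb_refl : reflexive congrb.
Proof. by move=> u; apply/asboolP; exact: congr_refl. Qed.

Lemma congrb_sym : symmetric congrb.
Proof. by move=> u v; apply/asboolP/asboolP; exact: congr_sym. Qed.

Lemma congrb_trans : transitive congrb.
Proof.
by move=> v u w /asboolP uv /asboolP vw; apply/asboolP; exact: congr_trans uv vw.
Qed.

Canonical congr_equiv := EquivRel congrb congrb_refl congrb_sym congrb_trans.

Definition smonoid := {eq_quot congr_equiv}.
HB.instance Definition _ := Choice.on smonoid.
HB.instance Definition _ := EqQuotient.on smonoid.

Definition cls (w : seq T) : smonoid := \pi_smonoid w.

Lemma clsP u v : cls u = cls v <-> congr u v.
Proof.
split=> [/eqquotP/asboolP//|uv]; apply/eqquotP/asboolP; exact: uv.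
Qed.

Lemma cls_repr (a : smonoid) : cls (repr a) = a.
Proof. exact: reprK. Qed.

Lemma congr_repr u : congr (repr (cls u)) u.
Proof. by apply/clsP; rewrite cls_repr. Qed.

Lemma congr_size u v : congr u v -> size u = size v.
Proof.
elim=> {u v} //= [u v w _ -> _ ->//|u u' v v' _ eu _ ev].
by rewrite !size_cat eu ev.
Qed.

Definition smul (a b : smonoid) : smonoid := cls (repr a ++ repr b).

Lemma smul_cls u v : smul (cls u) (cls v) = cls (u ++ v).
Proof. by apply/clsP; apply: congr_cat; exact: congr_repr. Qed.

Lemma smulA : associative smul.
Proof.
move=> a b c; rewrite -(cls_repr a) -(cls_repr b) -(cls_repr c).
by rewrite !smul_cls catA.
Qed.

Lemma smul1 : left_id (cls [::]) smul.
Proof. by move=> a; rewrite -(cls_repr a) smul_cls. Qed.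

Lemma smulr1 : right_id (cls [::]) smul.
Proof. by move=> a; rewrite -(cls_repr a) smul_cls cats0. Qed.

HB.instance Definition _ := isMonoid.Build smonoid smulA smul1 smulr1.

Definition slen (a : smonoid) : nat := size (repr a).

Lemma slen_cls u : slen (cls u) = size u.
Proof. exact: congr_size (congr_repr u). Qed.

(* [pass x v] is the pair of the word ^x v and the letter x^v, obtained by
   moving x through v with r, one letter at a time. *)
Fixpoint pass (x : T) (v : seq T) : seq T * T :=
  if v is y :: v' then
    let p := pass (r (x, y)).2 v' in ((r (x, y)).1 :: p.1, p.2)
  else ([::], x).

(* [passw u v] is the pair of words (^u v, u^v); the recursion is
   ^(xu)v = ^x(^u v) and (xu)^v = x^(^u v) u^v. *)
Fixpoint passw (u v : seq T) : seq T * seq T :=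
  if u is x :: u' then
    let p := passw u' v in
    ((pass x p.1).1, (pass x p.1).2 :: p.2)
  else (v, [::]).

(* The actions of the monoid on itself. For a braided r they do not depend on
   the chosen representatives, and they are the unique extension of the actions
   of r on T: see [extends_actions_act] and [extends_actions_uniq]. *)
Definition lact (a b : smonoid) : smonoid := cls (passw (repr a) (repr b)).1.
Definition ract (a b : smonoid) : smonoid := cls (passw (repr a) (repr b)).2.

Definition extends_actions (L R : smonoid -> smonoid -> smonoid) : Prop :=
  (forall x y, L (cls [:: x]) (cls [:: y]) = cls [:: (r (x, y)).1]) /\
  (forall x y, R (cls [:: x]) (cls [:: y]) = cls [:: (r (x, y)).2]) /\
  (forall a, L a 1%g = 1%g) /\ (forall u, L 1%g u = u) /\
  (forall u, R 1%g u = 1%g) /\ (forall a, R a 1%g = a) /\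
  (forall a b u, L (a * b)%g u = L a (L b u)) /\
  (forall a u v, R a (u * v)%g = R (R a u) v) /\
  (forall a u v, L a (u * v)%g = (L a u * L (R a u) v)%g) /\
  (forall a b u, R (a * b)%g u = (R a (L b u) * R b u)%g) /\
  (forall u v, (L u v * R u v)%g = (u * v)%g) /\
  (forall a u, slen (L a u) = slen u) /\
  (forall a u, slen (R u a) = slen u).

Lemma size_pass x v : size (pass x v).1 = size v.
Proof. by elim: v x => //= y v IH x; rewrite IH. Qed.

Lemma size_passw1 u v : size (passw u v).1 = size v.
Proof. by elim: u => //= x u IH; rewrite size_pass. Qed.

Lemma size_passw2 u v : size (passw u v).2 = size u.
Proof. by elim: u => //= x u ->. Qed.

Lemma slen_lact a b : slen (lact a b) = slen b.
Proof. by rewrite slen_cls size_passw1. Qed.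

Lemma slen_ract a b : slen (ract a b) = slen a.
Proof. by rewrite slen_cls size_passw2. Qed.

Lemma pass_cat x v w :
  pass x (v ++ w) =
  ((pass x v).1 ++ (pass (pass x v).2 w).1, (pass (pass x v).2 w).2).
Proof.
by elim: v x => [|y v IH] x /=; [rewrite -surjective_pairing | rewrite IH].
Qed.

Lemma passw_catl u u' v :
  passw (u ++ u') v =
  ((passw u (passw u' v).1).1,
   (passw u (passw u' v).1).2 ++ (passw u' v).2).
Proof.
by elim: u => [|x u IH] /=; [rewrite -surjective_pairing | rewrite IH].
Qed.

Lemma passw_catr u v w :
  passw u (v ++ w) =
  ((passw u v).1 ++ (passw (passw u v).2 w).1, (passw (passw u v).2 w).2).
Proof. by elim: u => [|x u IH] //=; rewrite IH pass_cat. Qed.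

Lemma passw0 u : passw u [::] = ([::], u).
Proof. by elim: u => //= x u ->. Qed.

Lemma passw1 x v : passw [:: x] v = ((pass x v).1, [:: (pass x v).2]).
Proof. by []. Qed.

Lemma congr_passw u v : congr ((passw u v).1 ++ (passw u v).2) (u ++ v).
Proof.
have pass_congr x w : congr (rcons (pass x w).1 (pass x w).2) (x :: w).
  elim: w x => [|y w IH] x /=; first exact: congr_refl.
  apply: congr_trans (congr_cat (congr_refl [:: _]) (IH _)) _.
  exact: congr_cat (congr_sym (congr_rel x y)) (congr_refl w).
elim: u => [|x u IH] /=; first by rewrite cats0; exact: congr_refl.
apply: congr_trans (congr_cat (congr_refl [:: x]) IH).
rewrite -cat_rcons -[[:: x] ++ _]/((x :: _) ++ _).
exact: congr_cat (pass_congr _ _) (congr_refl _).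
Qed.

Hypothesis br : braided r.

Lemma congr_passwl u u' v : congr u u' ->
  (passw u v).1 = (passw u' v).1 /\ congr (passw u v).2 (passw u' v).2.
Proof.
move=> uu'; elim: uu' v => {u u'} [x y|u|u u' _ IH|u v w _ IH _ IH'|u u' v v' _ IH _ IH'] w0.
- rewrite /=; elim: w0 x y => [|z w IH] x y /=.
    by split=> //; exact: congr_rel.
  have := br (x, y, z); rewrite /=; set p := r (x, y).
  case: (r (y, z)) => z1 y1 /=; case E: (r (x, z1)) => [z2 x1] /=.
  case E': (r (p.2, z)) => [z1' x2] /=; case E'': (r (p.1, z1')) => [z2' y2] /=.
  move=> [-> e1 e2]; have [/= IH1 IH2] := IH x1 y1.
  rewrite e1 e2; split; first by rewrite IH1.
  exact: IH2.
- by split=> //; exact: congr_refl.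
- by have [-> h] := IH w0; split=> //; exact: congr_sym.
- have [-> h] := IH w0; have [-> h'] := IH' w0.
  by split=> //; exact: congr_trans h h'.
- rewrite !passw_catl /=; have [-> h'] := IH' w0.
  by have [-> h] := IH (passw v' w0).1; split=> //; exact: congr_cat.
Qed.

Lemma congr_passwr u v v' : congr v v' ->
  congr (passw u v).1 (passw u v').1 /\ (passw u v).2 = (passw u v').2.
Proof.
move=> vv'; elim: vv' u => {v v'} [y z|v|v v' _ IH|u v w _ IH _ IH'|u u' v v' _ IH _ IH'] u0.
- pose q := r (y, z); rewrite -[r (y, z)]/q.
  suff [y' [z' [-> -> e]]] : exists y' z',
      [/\ (passw u0 [:: y; z]).1 = [:: y'; z'],
          (passw u0 [:: q.1; q.2]).1 = [:: (r (y', z')).1; (r (y', z')).2]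
        & (passw u0 [:: y; z]).2 = (passw u0 [:: q.1; q.2]).2].
    by split=> //; exact: congr_rel.
  elim: u0 => [|x u [y' [z' [e1 e2 e3]]]] /=; first by exists y, z.
  rewrite e1 e2 e3 /=.
  have := br (x, y', z'); rewrite /=.
  case: (r (x, y')) => y1 x1 /=; case: (r (x1, z')) => z1 x2 /=.
  case: (r (y', z')) => a b /=; case: (r (x, a)) => a1 x3 /=.
  case: (r (x3, b)) => b1 x4 /=.
  by case E: (r (y1, z1)) => [c1 c2] /= [<- <- <-]; exists y1, z1; rewrite E.
- by split=> //; exact: congr_refl.
- by have [h ->] := IH u0; split=> //; exact: congr_sym.
- have [h ->] := IH u0; have [h' ->] := IH' u0.
  by split=> //; exact: congr_trans h h'.
- rewrite !passw_catr /=; have [h ->] := IH u0.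
  by have [h' ->] := IH' (passw u0 u').2; split=> //; exact: congr_cat.
Qed.

Lemma lact_cls u v : lact (cls u) (cls v) = cls (passw u v).1.
Proof.
apply/clsP; have [-> _] := congr_passwl (repr (cls v)) (congr_repr u).
by have [] := congr_passwr u (congr_repr v).
Qed.

Lemma ract_cls u v : ract (cls u) (cls v) = cls (passw u v).2.
Proof.
apply/clsP; have [_ h] := congr_passwl (repr (cls v)) (congr_repr u).
by apply: congr_trans h _; have [_ ->] := congr_passwr u (congr_repr v);
  exact: congr_refl.
Qed.

Lemma mul_cls u v : (cls u * cls v)%g = cls (u ++ v).
Proof. exact: smul_cls. Qed.

Lemma extends_actions_act : extends_actions lact ract.
Proof.
have cE (P : smonoid -> Prop) : (forall w, P (cls w)) -> forall a, P a.
  by move=> h a; rewrite -(cls_repr a).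
have oneE : 1%g = cls [::] :> smonoid by [].
split; first by move=> x y; rewrite lact_cls.
split; first by move=> x y; rewrite ract_cls.
split; first by elim/cE => u; rewrite oneE lact_cls passw0.
split; first by elim/cE => u; rewrite oneE lact_cls.
split; first by elim/cE => u; rewrite oneE ract_cls.
split; first by elim/cE => u; rewrite oneE ract_cls passw0.
split.
  elim/cE=> a; elim/cE=> b; elim/cE=> u.
  by rewrite mul_cls !lact_cls passw_catl.
split.
  elim/cE=> a; elim/cE=> u; elim/cE=> v.
  by rewrite mul_cls !ract_cls passw_catr.
split.
  elim/cE=> a; elim/cE=> u; elim/cE=> v.
  by rewrite mul_cls ract_cls !lact_cls mul_cls passw_catr.
split.
  elim/cE=> a; elim/cE=> b; elim/cE=> u.
  by rewrite mul_cls lact_cls !ract_cls mul_cls passw_catl.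
split.
  elim/cE=> u; elim/cE=> v; rewrite lact_cls ract_cls !mul_cls.
  by apply/clsP; exact: congr_passw.
by split=> a u; [exact: slen_lact | exact: slen_ract].
Qed.

Lemma extends_actions_uniq L R : extends_actions L R ->
  forall a b, L a b = lact a b /\ R a b = ract a b.
Proof.
case=> Lx [Rx [L1 [L1u [R1u [R1 [LM [RM [LD [RD _]]]]]]]]] a b.
rewrite -(cls_repr a) -(cls_repr b) lact_cls ract_cls.
have consE x u : cls (x :: u) = (cls [:: x] * cls u)%g by rewrite mul_cls.
have letter x v : L (cls [:: x]) (cls v) = cls (pass x v).1
               /\ R (cls [:: x]) (cls v) = cls [:: (pass x v).2].
  elim: v x => [|y v IH] x /=; first by rewrite L1 R1.
  have [IH1 IH2] := IH (r (x, y)).2.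
  rewrite (consE y v) LD RM Lx Rx; split; last exact: IH2.
  by rewrite IH1 mul_cls.
elim: (repr a) (repr b) => [|x u IH] v /=; first by rewrite L1u R1u.
have [IH1 IH2] := IH v; have [l1 l2] := letter x (passw u v).1.
rewrite (consE x u) LM RD IH1 IH2; split; first exact: l1.
by rewrite l2 mul_cls.
Qed.

End AssociatedMonoid.

Section Veronese.
Variables (n : nat) (r : 'I_n * 'I_n -> 'I_n * 'I_n).
Local Notation S := (smonoid r).

Definition deglex (u v : seq 'I_n) : bool :=
  (size u < size v) ||
  (size u == size v) && (u <= v :> seqlexi 'I_n)%O.

Definition normal_word (w : seq 'I_n) : bool :=
  `[< forall v, cls r v = cls r w -> deglex w v >].

Lemma deglex_anti : antisymmetric deglex.
Proof.
move=> u v /andP[/orP[uv|/andP[/eqP e uv]] /orP[vu|/andP[/eqP e' vu]]].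
- by have := ltn_trans uv vu; rewrite ltnn.
- by move: uv; rewrite e' ltnn.
- by move: vu; rewrite e ltnn.
- by apply/eqP; rewrite (@eq_le _ (seqlexi 'I_n)) uv.
Qed.

Lemma exists_normal (a : S) : exists w, normal_word w && (cls r w == a).
Proof.
pose m := slen a.
pose P (t : m.-tuple 'I_n) := cls r t == a.
have Pr : P (in_tuple (repr a)) by rewrite /P cls_repr.
case: (Order.TotalTheory.arg_minP (fun t => tval t : seqlexi 'I_n) Pr) => t Pt tmin.
exists t; rewrite [X in _ && X]Pt andbT; apply/asboolP => v vt.
have sv : size v = m by rewrite -(slen_cls r v) vt (eqP Pt).
rewrite /deglex size_tuple sv ltnn eqxx /=.
have /eqP sv' := sv.
by apply: (tmin (Tuple sv')); rewrite /P /= vt.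
Qed.

Definition nor (a : S) : seq 'I_n := xchoose (exists_normal a).

Lemma normal_nor a : normal_word (nor a).
Proof. by have /andP[] := xchooseP (exists_normal a). Qed.

Lemma cls_nor a : cls r (nor a) = a.
Proof. by have /andP[_ /eqP] := xchooseP (exists_normal a). Qed.

Lemma nor_uniq a w : normal_word w -> cls r w = a -> w = nor a.
Proof.
move=> /asboolP nw wa; have /asboolP nn := normal_nor a.
by apply: deglex_anti; rewrite nw ?nn// ?wa cls_nor.
Qed.

Lemma size_nor a : size (nor a) = slen a.
Proof. by rewrite -(slen_cls r) cls_nor. Qed.

Variable d : nat.

Definition normal_words := {w : d.-tuple 'I_n | normal_word w}.
HB.instance Definition _ := SubFinite.on normal_words.

Definition word (w : normal_words) : seq 'I_n := val w.

Lemma slen_word w : slen (cls r (word w)) = d.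
Proof. by rewrite slen_cls size_tuple. Qed.

Lemma size_nor_lact (v w : normal_words) :
  size (nor (lact (cls r (word v)) (cls r (word w)))) == d.
Proof. by rewrite size_nor slen_lact slen_word. Qed.

Lemma size_nor_ract (v w : normal_words) :
  size (nor (ract (cls r (word v)) (cls r (word w)))) == d.
Proof. by rewrite size_nor slen_ract slen_word. Qed.

Definition veronese (p : normal_words * normal_words) :
    normal_words * normal_words :=
  let: (v, w) := p in
  (exist _ (Tuple (size_nor_lact v w)) (normal_nor _),
   exist _ (Tuple (size_nor_ract v w)) (normal_nor _)).

Lemma word_veronese v w :
  word (veronese (v, w)).1 = nor (lact (cls r (word v)) (cls r (word w))) /\
  word (veronese (v, w)).2 = nor (ract (cls r (word v)) (cls r (word w))).
Proof. by []. Qed.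

End Veronese.

(* Main.v *)
Require Import Defs.
From mathcomp Require Import all_boot all_order all_fingroup.
From mathcomp Require Import boolp.

(** The defining relations [x y = f(y) y] identify [x y] with [x' y] for all
letters [x], [x'], so inside a nonempty word every letter but the last can be
changed freely, while the length and the last letter never change.  Hence two
words are equal in the monoid exactly when they have the same length and the
same last letter ([congr_rcons], [congr_last], [congr_size]), and the normal
word of length [k + 1] with last letter [q] is [x1^k q]: it is lexicographically
least because each of its free letters is the least letter
([normal_word_pow_rcons]).

The actions are then read off on last letters.  Moving a letter [x]
rightwards through a word [v] applies [f] to every letter of [v] and turns
[x] into the last letter of [v] ([pass_perm_sol]).  Thus a word [u] of length
[d] acts on [v] on the left by applying [f^d] letterwise ([passw_perm_sol1]),
and [u^v] still ends with the last letter of [v], because the rightmost letter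
of [u] passes through [v] itself, before any power of [f] has been applied
([last_passw_perm_sol2]).  Identifying a normal word of length [d] with its last
letter, the Veronese map becomes [(p, q) |-> (f^d q, q)]. *)

Section PermutationMonoid.
Variables (n : nat) (f : {perm 'I_n}).
Local Notation r := (perm_sol f).
Implicit Types (u v : seq 'I_n) (q x : 'I_n).

Lemma congr_last {u v} x : congr r u v -> last x u = last x v.
Proof.
move=> uv; elim: uv x => {u v} //.
- by move=> u v w _ IH _ IH' x; rewrite IH.
- by move=> u u' v v' _ IH _ IH' x; rewrite !last_cat IH.
Qed.

(** Both [x v] and [y v] equal [f(z) v], where [z] is the first letter of the
nonempty word [v]. *)
Lemma congr_head x y v : v != [::] -> congr r (x :: v) (y :: v).
Proof.
case: v => // z v _.
apply: (congr_cat (u := [:: x; z]) (u' := [:: y; z])); last exact: congr_refl.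
exact: congr_trans (congr_rel r x z) (congr_sym (congr_rel r y z)).
Qed.

Lemma congr_rcons u v q :
  size u = size v -> congr r (rcons u q) (rcons v q).
Proof.
elim: u v => [|x u IH] [|y v] //=; first by move=> _; exact: congr_refl.
move=> [suv].
apply: (congr_trans (v := x :: rcons v q)).
  exact: (congr_cat (congr_refl r [:: x]) (IH v suv)).
by apply: congr_head; case: (v).
Qed.

Lemma pass_perm_sol x v : pass r x v = (map f v, last x v).
Proof. by elim: v x => //= y v IH x; rewrite IH. Qed.

Lemma passw_perm_sol1 u v : (passw r u v).1 = map (f ^+ size u)%g v.
Proof.
elim: u => [|x u IH] /=.
  by rewrite -[LHS]map_id; apply: eq_map => q; rewrite perm1.
rewrite pass_perm_sol IH -map_comp; apply: eq_map => q /=.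
by rewrite expgSr permM.
Qed.

(** The recursion adds letters at the front of [u], hence at the front of
[u^v]; its last letter is produced by the last letter of [u] crossing [v q]. *)
Lemma last_passw_perm_sol2 x u v q :
  u != [::] -> last x (passw r u (rcons v q)).2 = q.
Proof.
elim: u x => // y [|z u] IH x _; last exact: IH.
by rewrite /= pass_perm_sol last_rcons.
Qed.

Variables (x1 : 'I_n) (x1_min : forall q, x1 <= q).
Local Notation pow_rcons k q := (nseq k x1 ++ [:: q]).

(** Words with the same last letter compare as their beginnings do, and a block
of least letters is the least beginning of its length. *)
Lemma pow_rcons_min k v q :
  size v = k -> (pow_rcons k q <= rcons v q :> seqlexi 'I_n)%O.
Proof.
elim: v k => [|y v IH] [|k] //= [sv].
by rewrite Order.SeqLexiOrder.lexi_cons leEord x1_min IH // implybT.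
Qed.

Lemma normal_word_pow_rcons k q : normal_word r (pow_rcons k q).
Proof.
apply/asboolP => v /clsP e.
have sv : size v = k.+1 by rewrite (congr_size e) cats1 size_rcons size_nseq.
have := congr_last x1 e.
case/lastP: v sv {e} => // v y; rewrite size_rcons cats1 !last_rcons.
move=> [sv] ->; rewrite /deglex -cats1 size_cat size_nseq addn1 size_rcons sv.
by rewrite ltnn eqxx; exact: pow_rcons_min.
Qed.

Lemma deglex_pow_rcons k p q :
  deglex (pow_rcons k p) (pow_rcons k q) = (p <= q).
Proof.
rewrite /deglex !size_cat ltnn eqxx /=; elim: k => [|k IH] /=.
  by rewrite Order.SeqLexiOrder.lexi_cons Order.SeqLexiOrder.lexi0s implybT andbT.
by rewrite Order.SeqLexiOrder.lexi_cons Order.POrderTheory.lexx.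
Qed.

Lemma nor_cls k v q :
  size v = k.+1 -> last x1 v = q -> nor (cls r v) = pow_rcons k q.
Proof.
case/lastP: v => // v y; rewrite size_rcons last_rcons => -[sv] <-.
apply/esym/nor_uniq; first exact: normal_word_pow_rcons.
by apply/clsP; rewrite cats1; apply: congr_rcons; rewrite size_nseq sv.
Qed.

Variable k : nat.
Local Notation Nd := (normal_words r k.+1).

Lemma size_pow_rcons q : size (pow_rcons k q) == k.+1.
Proof. by rewrite size_cat size_nseq addn1. Qed.

Definition nword q : Nd :=
  exist _ (Tuple (size_pow_rcons q)) (normal_word_pow_rcons k q).

(** The default [x1] is never returned, the words being nonempty. *)
Definition last_letter (v : Nd) : 'I_n := last x1 (word v).

Lemma word_inj : injective (@word n r k.+1).
Proof. by move=> u v uv; apply/val_inj/val_inj. Qed.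

Lemma nwordK : cancel nword last_letter.
Proof. by move=> q; rewrite /last_letter /= last_cat. Qed.

(** A class contains a single normal word, so that a normal word is determined
by its length and its last letter. *)
Lemma last_letterK : cancel last_letter nword.
Proof.
move=> v; apply: word_inj.
apply: etrans (esym (nor_cls k (word v) _ (size_tuple (val v)) erefl)) _.
by apply/esym/nor_uniq => //; exact: (valP v).
Qed.

Lemma nword_bij : bijective nword.
Proof. exact: Bijective nwordK last_letterK. Qed.

Lemma nword_perm_inj (g : {perm 'I_n}) :
  injective (fun v : Nd => nword (g (last_letter v))).
Proof.
apply: inj_comp (can_inj nwordK) _.
exact: inj_comp perm_inj (can_inj last_letterK).
Qed.

Definition nword_perm (g : {perm 'I_n}) : {perm Nd} := perm (nword_perm_inj g).

Lemma nword_permE g q : nword_perm g (nword q) = nword (g q).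
Proof. by rewrite permE nwordK. Qed.

Lemma veronese_nword p q :
  @veronese n r k.+1 (nword p, nword q) = (nword ((f ^+ k.+1)%g q), nword q).
Proof.
have br := perm_sol_braided f.
have [e1 e2] := word_veronese (nword p) (nword q).
have sp : size (word (nword p)) = k.+1 by rewrite size_tuple.
rewrite [LHS]surjective_pairing; congr pair; apply: word_inj.
- rewrite e1 lact_cls //; apply: nor_cls.
    by rewrite size_passw1 size_tuple.
  by rewrite passw_perm_sol1 sp /= map_cat last_cat.
- rewrite e2 ract_cls //; apply: nor_cls.
    by rewrite size_passw2 size_tuple.
  by rewrite [word (nword q)]cats1 last_passw_perm_sol2 // -size_eq0 sp.
Qed.

End PermutationMonoid.

Theorem corollary6p9 (n d : nat) (hn : 2 <= n) (hd : 2 <= d) (f : {perm 'I_n}) :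
  let x1 : 'I_n := Ordinal (ltnW hn) in
  let Nd := normal_words (perm_sol f) d in
  let rho : Nd * Nd -> Nd * Nd := @veronese n (perm_sol f) d in
  is_perm_idem_sol rho /\ #|{: Nd}| = n /\
  exists w : 'I_n -> Nd,
    bijective w /\
    (forall p q : 'I_n, deglex (word (w p)) (word (w q)) = (p <= q)) /\
    (forall q : 'I_n, word (w q) = nseq d.-1 x1 ++ [:: q]) /\
    exists F : {perm Nd},
      (forall p q : 'I_n, rho (w p, w q) = (F (w q), w q)) /\
      (forall q : 'I_n, word (F (w q)) = nseq d.-1 x1 ++ [:: (f ^+ d)%g q]).
Proof.
case: d hd => // k _ x1 Nd rho.
have x1_min (q : 'I_n) : x1 <= q by [].
pose w := nword n f x1 x1_min k.
pose F := nword_perm n f x1 x1_min k (f ^+ k.+1)%g.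
have wbij : bijective w by exact: nword_bij.
have rhoE p q : rho (w p, w q) = (F (w q), w q).
  by rewrite /rho /w /F veronese_nword nword_permE.
split.
  exists F => x y; have [g _ gK] := wbij.
  by rewrite -(gK x) -(gK y) rhoE.
split; first by rewrite -(bij_eq_card wbij) card_ord.
exists w; split=> //; split; first by move=> p q; exact: deglex_pow_rcons.
split=> //; exists F; split=> // q.
by rewrite /F /w nword_permE.
Qed.
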